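(* Let $\mathcal{A}_d:Q\times Q\to G$ be the discrete connection $1$-form of a discrete connection on the principal bundle $\pi:Q\to Q/G$. Then: 1. $\mathcal{A}_d$ is $G$-equivariant, that is, $\mathcal{A}_d(gq_0,gq_1)=g\,\mathcal{A}_d(q_0,q_1)\,g^{-1}$ for all $g\in G$ and $q_0,q_1\in Q$; 2. $\mathcal{A}_d$ induces a splitting of the discrete Atiyah sequence, in the sense that $\mathcal{A}_d(i_q(g))=\mathcal{A}_d(q,gq)=g$ for all $q\in Q$ and $g\in G$.
   Context: $Q$ is a smooth manifold with a free smooth left action $(g,q)\mapsto gq$ of a Lie group $G$ such that the projection $\pi:Q\to S=Q/G$ is a submersion; $e$ is the identity of $G$. $G$ acts on $Q\times Q$ diagonally, $g\cdot(q_0,q_1)=(gq_0,gq_1)$. The discrete generator is $i_q(g)=(q,gq)$, and the discrete vertical space at $q$ is $\operatorname{Ver}_q=\{(q,q')\mid \pi(q)=\pi(q')\}=\{i_q(g)\mid g\in G\}$. The composition of a vertical element with an arbitrary element is $i_{q_0}(g)\cdot(q_0,q_1)=(q_0,gq_1)$. A discrete connection is a $G$-invariant subset $\operatorname{Hor}\subset Q\times Q$ (the discrete horizontal space; $\operatorname{Hor}_q$ denotes its elements with first component $q$) complementary to the vertical space: $\operatorname{Hor}_q\cap\operatorname{Ver}_q=\{(q,q)\}$ for every $q$, and every $(q_0,q_1)\in Q\times Q$ can be written uniquely as $(q_0,q_1)=\operatorname{ver}(q_0,q_1)\cdot\operatorname{hor}(q_0,q_1)$ with $\operatorname{ver}(q_0,q_1)\in\operatorname{Ver}_{q_0}$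 and $\operatorname{hor}(q_0,q_1)\in\operatorname{Hor}_{q_0}$. $G$-equivariance means $\operatorname{hor}(gq_0,gq_1)=g\cdot\operatorname{hor}(q_0,q_1)$ and $\operatorname{ver}(gq_0,gq_1)=g\cdot\operatorname{ver}(q_0,q_1)$. The discrete connection $1$-form of the discrete connection is the map $\mathcal{A}_d:Q\times Q\to G$ where $\mathcal{A}_d(q_0,q_1)$ is the unique $g\in G$ with $i_{q_0}(g)=\operatorname{ver}(q_0,q_1)$; equivalently $(q_0,q_1)=i_{q_0}(\mathcal{A}_d(q_0,q_1))\cdot\operatorname{hor}(q_0,q_1)$. *)

(* Defs.v *)
From HB Require Import structures.
From mathcomp Require Import all_boot all_order all_algebra.
From mathcomp Require Import boolp classical_sets functions cardinality.
From mathcomp Require Import reals topology normedtype derive.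
Import Order.TTheory GRing.Theory Num.Theory numFieldNormedType.Exports.

Set Implicit Arguments.
Unset Strict Implicit.
Unset Printing Implicit Defensive.

Local Open Scope classical_set_scope.
Local Open Scope ring_scope.

(* Manifolds are real, over any R : realType, and modelled on 'rV[R]_n. *)
Section Smooth.
Context {R : realType}.

(* On an open set U this is C^k: for f : R^n -> R^p, being C^(k+1) amounts to
   being continuous with all directional derivatives existing and C^k. *)
Fixpoint Ck_on (k : nat) (n p : nat) (U : set 'rV[R]_n)
    (f : 'rV[R]_n -> 'rV[R]_p) : Prop :=
  (forall x, U x -> {for x, continuous f}) /\
  (if k is k'.+1 then
     forall v : 'rV[R]_n,
       (forall x, U x -> derivable f x v) /\ Ck_on k' U (fun x => 'D_v f x)
   else True).

Definition smooth_on (n p : nat) (U : set 'rV[R]_n)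
    (f : 'rV[R]_n -> 'rV[R]_p) : Prop :=
  forall k, Ck_on k U f.

(* Raw data: [coord] is only meaningful on [cdom], and its inverse [param] only
   on [coord @` cdom]; see [chart_axiom]. *)
Record chart (M : Type) (n : nat) := Chart {
  cdom : set M;
  coord : M -> 'rV[R]_n;
  param : 'rV[R]_n -> M }.

Definition ctarget (M : Type) n (c : chart M n) : set 'rV[R]_n :=
  coord c @` cdom c.

(* [coord c] is a homeomorphism from an open set of M onto an open set of R^n. *)
Record chart_axiom (M : topologicalType) n (c : chart M n) : Prop := {
  open_cdom : open (cdom c);
  open_ctarget : open (ctarget c);
  coordK : forall x, cdom c x -> param c (coord c x) = x;
  coord_continuous : forall x, cdom c x -> {for x, continuous (coord c)};
  param_continuous : forall y, ctarget c y -> {for y, continuous (param c)} }.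

Definition compatible (M : Type) n (c d : chart M n) : Prop :=
  smooth_on (coord c @` (cdom c `&` cdom d)) (coord d \o param c).

(* The atlas is not required to be maximal: smoothness of maps can be tested on
   any atlas of the smooth structure. *)
Record smooth_manifold (M : topologicalType) (n : nat) := SmoothManifold {
  atlas :> set (chart M n);
  manifold_hausdorff : hausdorff_space M;
  manifold_second_countable : @second_countable M;
  atlas_chart : forall c, atlas c -> chart_axiom c;
  atlas_cover : forall x, exists2 c, atlas c & cdom c x;
  atlas_compatible : forall c d, atlas c -> atlas d -> compatible c d }.

Definition prod_chart (M N : Type) m n (c : chart M m) (d : chart N n) :
    chart (M * N) (m + n) :=
  Chart (cdom c `*` cdom d)
    (fun p => row_mx (coord c p.1) (coord d p.2))
    (fun x => (param c (lsubmx x), param d (rsubmx x))).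

Definition prod_atlas (M N : Type) m n
    (A : set (chart M m)) (B : set (chart N n)) : set (chart (M * N) (m + n)) :=
  [set e | exists c d, [/\ A c, B d & e = prod_chart c d]].

Definition local_rep (M N : Type) m n (c : chart M m) (d : chart N n)
    (f : M -> N) : 'rV[R]_m -> 'rV[R]_n :=
  coord d \o f \o param c.

Definition smooth_map (M N : topologicalType) m n
    (A : set (chart M m)) (B : set (chart N n)) (f : M -> N) : Prop :=
  continuous f /\
  forall c d, A c -> B d ->
    smooth_on (coord c @` (cdom c `&` f @^-1` cdom d)) (local_rep c d f).

Definition submersion (M N : topologicalType) m n
    (A : set (chart M m)) (B : set (chart N n)) (f : M -> N) : Prop :=
  smooth_map A B f /\
  forall c d x, A c -> B d -> cdom c x -> cdom d (f x) ->
    forall w : 'rV[R]_n, exists v : 'rV[R]_m,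
      'd (local_rep c d f) (coord c x) v = w.

End Smooth.

Arguments chart R M n : clear implicits.
Arguments smooth_manifold R M n : clear implicits.

(* A type carrying both a group law and a topology; their compatibility is part
   of [lie_group]. *)
#[short(type="groupTopologicalType")]
HB.structure Definition GroupTopological := {G of Group G & Topological G}.

Definition lie_group (R : realType) (G : groupTopologicalType) (m : nat)
    (AG : smooth_manifold R G m) : Prop :=
  smooth_map (prod_atlas AG AG) AG (fun p : G * G => (p.1 * p.2)%g) /\
  smooth_map AG AG (fun g : G => (g^-1)%g).

Record left_action (G : groupType) (Q : Type) := LeftAction {
  act :> G -> Q -> Q;
  act1g : forall q, act 1%g q = q;
  actMg : forall g h q, act (g * h)%g q = act g (act h q) }.

Definition free_action (G : groupType) (Q : Type) (a : left_action G Q) : Prop :=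
  forall g q, a g q = q -> g = 1%g.

Section OrbitSpace.
Variables (G : groupType) (Q : topologicalType) (a : left_action G Q).

Definition same_orbit (q q' : Q) : bool := `[< exists g, a g q = q' >].

Lemma same_orbit_refl : reflexive same_orbit.
Proof. by move=> q; apply/asboolP; exists 1%g; rewrite act1g. Qed.

Lemma same_orbit_sym : symmetric same_orbit.
Proof.
suff H q q' : same_orbit q q' -> same_orbit q' q.
  by move=> q q'; apply/idP/idP; exact: H.
move=> /asboolP[g <-]; apply/asboolP.
by exists (g^-1)%g; rewrite -actMg mulVg act1g.
Qed.

Lemma same_orbit_trans : transitive same_orbit.
Proof.
move=> q2 q1 q3 /asboolP[g <-] /asboolP[h <-]; apply/asboolP.
by exists (h * g)%g; rewrite actMg.
Qed.

Definition orbit_equiv : equiv_rel Q :=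
  EquivRel same_orbit same_orbit_refl same_orbit_sym same_orbit_trans.

(* S = Q/G with the quotient topology *)
Definition orbit_space : topologicalType :=
  quotient_topology {eq_quot orbit_equiv}%qT.

Definition orbit_proj (q : Q) : orbit_space :=
  (\pi_{eq_quot orbit_equiv} q)%qT.

Lemma orbit_projP q q' :
  orbit_proj q = orbit_proj q' <-> exists g, a g q = q'.
Proof.
by split=> [/eqmodP/asboolP//|H]; apply/eqmodP; apply/asboolP.
Qed.

End OrbitSpace.

Section DiscreteConnection.
Variables (G : groupType) (Q : topologicalType) (a : left_action G Q).

Definition diag_act (g : G) (p : Q * Q) : Q * Q := (a g p.1, a g p.2).

Definition disc_gen (q : Q) (g : G) : Q * Q := (q, a g q).

Definition Ver (q : Q) : set (Q * Q) :=
  [set p | p.1 = q /\ orbit_proj a p.1 = orbit_proj a p.2].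

Lemma Ver_disc_gen q : Ver q = range (disc_gen q).
Proof.
apply/seteqP; split=> [[q0 q1] [/= -> /orbit_projP[g <-]]|_ [g _ <-]].
  by exists g.
by split=> //=; apply/orbit_projP; exists g.
Qed.

(* For a free action, the unique g with v = i_q(g), where q = v.1, if v is
   vertical; the junk value 1 otherwise. *)
Definition gen_elt (v : Q * Q) : G :=
  xget 1%g [set g | disc_gen v.1 g = v].

(* i_q0(g) . (q0, q1) = (q0, g q1); only used for v vertical and
   v.1 = p.1. *)
Definition vcomp (v p : Q * Q) : Q * Q := (p.1, a (gen_elt v) p.2).

Definition slice (H : set (Q * Q)) (q : Q) : set (Q * Q) :=
  H `&` [set p | p.1 = q].

Record discrete_connection := DiscreteConnection {
  Hor : set (Q * Q);
  Hor_invariant : forall g, diag_act g @` Hor = Hor;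
  Hor_cap_Ver : forall q, slice Hor q `&` Ver q = [set (q, q)];
  Hor_decomp : forall p : Q * Q,
    exists! vh : (Q * Q) * (Q * Q),
      [/\ Ver p.1 vh.1, slice Hor p.1 vh.2 & p = vcomp vh.1 vh.2] }.

Variable C : discrete_connection.

Definition ver (p : Q * Q) : Q * Q := (sval (cid (Hor_decomp C p))).1.
Definition hor (p : Q * Q) : Q * Q := (sval (cid (Hor_decomp C p))).2.

Definition connection_form (p : Q * Q) : G :=
  xget 1%g [set g | disc_gen p.1 g = ver p].

End DiscreteConnection.

(* Main.v *)
(* If (q0, r) is horizontal then, by uniqueness of the decomposition and freeness,
   the connection form of (q0, g r) is g. Both claims follow from this: the
   diagonal is horizontal, and (h q0, h g r) = (h q0, (h g h^-1) (h r)) with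
   (h q0, h r) horizontal by invariance. *)
Require Import Defs.
From HB Require Import structures.
From mathcomp Require Import all_boot all_order all_algebra.
From mathcomp Require Import boolp classical_sets functions cardinality.
From mathcomp Require Import reals topology normedtype derive.

(** If [g] and [h] move [q] to the same point, then [h^-1 * g] fixes [q]. *)
Lemma free_action_inj (G : groupType) (Q : Type) (a : left_action G Q) (q : Q) :
  free_action a -> injective (a ^~ q).
Proof.
move=> a_free g h /= agh; apply/esym/(mulgI h^-1%g); rewrite mulVg.
by apply/esym/(a_free _ q); rewrite actMg agh -actMg mulVg act1g.
Qed.

Section ConnectionForm.
Variables (G : groupType) (Q : topologicalType) (a : left_action G Q).
Local Open Scope classical_set_scope.

(** Under freeness the choices in [gen_elt] and [connection_form] recover the generator of a
    vertical pair; the default [1] is never taken there. *)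
Lemma xget_disc_gen (q : Q) (g : G) : free_action a ->
  xget 1%g [set h | disc_gen a q h = disc_gen a q g] = g.
Proof.
move=> a_free; apply: xget_unique => // h [].
exact: (free_action_inj _ _ _ q a_free).
Qed.

Variable C : discrete_connection a.

Lemma Hor_diag (q : Q) : Hor C (q, q).
Proof.
have : (slice (Hor C) q `&` Ver a q) (q, q) by rewrite Hor_cap_Ver.
by case=> -[].
Qed.

Lemma Hor_act (g : G) (q r : Q) : Hor C (q, r) -> Hor C (a g q, a g r).
Proof. by move=> Hqr; rewrite -(Hor_invariant C g); exists (q, r). Qed.

Lemma connection_form_Hor (g : G) (q r : Q) :
  free_action a -> Hor C (q, r) -> connection_form C (q, a g r) = g.
Proof.
move=> a_free Hqr; rewrite /connection_form /ver; case: cid => vh [_ vh_uniq] /=.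
(* Uniqueness identifies the chosen decomposition with the evident one, whose vertical part is
   generated by [g]. *)
rewrite (vh_uniq (disc_gen a q g, (q, r))) /= ?xget_disc_gen//; split=> //.
  by rewrite Ver_disc_gen; exists g.
by rewrite /vcomp /gen_elt xget_disc_gen.
Qed.

(** The existence half of [Hor_decomp]: it brings any pair to the form that [connection_form_Hor]
    evaluates. *)
Lemma Hor_factor (q0 q1 : Q) : exists (g : G) (r : Q),
  Hor C (q0, r) /\ q1 = a g r.
Proof.
have [[v [q r]] [[/= _ [Hqr /= eq_q] [_ ->]] _]] := Hor_decomp C (q0, q1).
by exists (gen_elt a v), r; rewrite -eq_q.
Qed.

End ConnectionForm.

Theorem proposition4p3 (R : realType)
    (G : groupTopologicalType) (m : nat) (AG : smooth_manifold R G m)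
    (Q : topologicalType) (n : nat) (AQ : smooth_manifold R Q n)
    (a : left_action G Q)
    (s : nat) (AS : smooth_manifold R (orbit_space a) s)
    (G_lie : lie_group AG)
    (a_free : free_action a)
    (a_smooth : smooth_map (prod_atlas AG AQ) AQ (fun p : G * Q => a p.1 p.2))
    (proj_submersion : submersion AQ AS (orbit_proj a))
    (C : discrete_connection a) :
  (forall (g : G) (q0 q1 : Q),
     connection_form C (a g q0, a g q1)
     = (g * connection_form C (q0, q1) * g^-1)%g) /\
  (forall (q : Q) (g : G),
     connection_form C (disc_gen a q g) = connection_form C (q, a g q) /\
     connection_form C (q, a g q) = g).
Proof.
split=> [g q0 q1|q g].
  have [h [r [Hr ->]]] := Hor_factor _ _ _ C q0 q1.
  have -> : a g (a h r) = a (g * h * g^-1)%g (a g r) by rewrite -!actMg mulgVK.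
  by rewrite !connection_form_Hor//; exact: Hor_act.
(* This is the case [r = q] of [connection_form_Hor]. *)
by split=> //; apply: connection_form_Hor => //; exact: Hor_diag.
Qed.
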